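(* Let $n\ge 3$. If an antipodal $2$-edge-colouring of the hypercube $Q_n$ contains fewer than $3\cdot 2^{n-2}$ unresolved squares, then there exists a monochromatic path in $Q_n$ joining some vertex $v$ to its antipode $\tau(v)$.
   Context: $Q_n$ is the graph on $\{0,1\}^n$ in which two vertices are adjacent if they differ in exactly one coordinate, and $\tau(u_1,\dots,u_n)=(1-u_1,\dots,1-u_n)$ is the antipodal involution. A $2$-edge-colouring of $Q_n$ is a function $E(Q_n)\to\{\text{red},\text{blue}\}$; it is antipodal if the edges $uv$ and $\tau(u)\tau(v)$ have different colours for every edge $uv$. A path is monochromatic if all its edges have the same colour. A square (square face) of $Q_n$ is a $4$-cycle of $Q_n$ (obtained by letting two coordinates vary and fixing the others). Given a colouring, a square is resolved if some pair of opposite vertices of the square is connected by a monochromatic path in the whole graph $Q_n$ (the path need not stay in the square); otherwise it is unresolved. *)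

(* Defs.v *)
From mathcomp Require Import all_boot.

Set Implicit Arguments.
Unset Strict Implicit.
Unset Printing Implicit Defensive.

Definition vertex (n : nat) : finType := {ffun 'I_n -> bool}.

Definition antipode (n : nat) (u : vertex n) : vertex n := [ffun i => ~~ u i].

Definition adj (n : nat) (u v : vertex n) : bool :=
  #|[set i | u i != v i]| == 1.

Definition edges (n : nat) : {set {set vertex n}} :=
  [set e | [exists u : vertex n, exists v : vertex n,
             adj u v && (e == [set u; v])]].

Definition edge (n : nat) : finType := {e : {set vertex n} | e \in edges n}.

(* The two colours are the booleans: [true] is red and [false] is blue. *)
Definition colouring (n : nat) : Type := edge n -> bool.

Definition antipodal (n : nat) (c : colouring n) : Prop :=
  forall e e' : edge n, val e' = [set antipode u | u in val e] -> c e != c e'.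

Definition has_colour (n : nat) (c : colouring n) (b : bool) : rel (vertex n) :=
  fun u v => [exists e : edge n, (val e == [set u; v]) && (c e == b)].

(* As usual in MathComp, the path u :: p is given by its first vertex u and the
   sequence p of the following ones. *)
Definition mono_path (n : nat) (c : colouring n) (u : vertex n)
    (p : seq (vertex n)) : bool :=
  uniq (u :: p) && [exists b : bool, path (has_colour c b) u p].

Definition mono_joined (n : nat) (c : colouring n) (u v : vertex n) : Prop :=
  exists2 p : seq (vertex n), mono_path c u p & last u p = v.

(* Decision procedure for [mono_joined] (see [mono_joinedP]), needed in order
   to count squares. *)
Definition mono_joinedb (n : nat) (c : colouring n) (u v : vertex n) : bool :=
  [exists b : bool, connect (has_colour c b) u v].

Lemma mono_joinedP (n : nat) (c : colouring n) (u v : vertex n) :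
  reflect (mono_joined c u v) (mono_joinedb c u v).
Proof.
apply: (iffP existsP) => [[b /connectP [p bp ->]] | [p /andP [_ /existsP [b bp]] <-]].
  case/shortenP: bp => p' bp' up' _.
  by exists p' => //; rewrite /mono_path up'; apply/existsP; exists b.
by exists b; apply/connectP; exists p.
Qed.

(* The set of vertices of the square through u in which the coordinates i and j
   vary. *)
Definition face (n : nat) (u : vertex n) (i j : 'I_n) : {set vertex n} :=
  [set v : vertex n | [forall k, (k != i) && (k != j) ==> (v k == u k)]].

(* A 4-cycle of the hypercube is determined by its set of vertices. *)
Definition squares (n : nat) : {set {set vertex n}} :=
  [set S | [exists u : vertex n, exists i, exists j,
             (i != j) && (S == face u i j)]].

(* Opposite vertices of a 4-cycle of the hypercube are its distinct
   non-adjacent vertices: the hypercube is bipartite, so the cycle is induced. *)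
Definition opposite (n : nat) (S : {set vertex n}) (u v : vertex n) : bool :=
  [&& u \in S, v \in S, u != v & ~~ adj u v].

Definition resolved (n : nat) (c : colouring n) (S : {set vertex n}) : bool :=
  [exists u, exists v, opposite S u v && mono_joinedb c u v].

Definition unresolved_squares (n : nat) (c : colouring n) :
    {set {set vertex n}} :=
  [set S in squares n | ~~ resolved c S].

(* Main.v *)
Require Import Defs.
From mathcomp Require Import all_boot fingroup perm zify.
Set Implicit Arguments.
Unset Strict Implicit.
Unset Printing Implicit Defensive.

(** Suppose that no vertex is joined to its antipode.  Label each vertex v by its
    red component [red_comp v] and by [blue_comp v], the red component of its
    antipode; since the antipodal map exchanges the colours, the latter labels
    the blue component of v by a red one.  Both labels live in the same set, the
    antipodal map exchanges them, and they differ at every v.  Two vertices are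
    joined by a monochromatic path exactly when they share a red or a blue label;
    so an unresolved square has alternating colours, and the two red and two blue
    labels that occur at its vertices are four distinct ones.

    Fix a linear order on the labels and let the tilt of v say which of its two
    labels is the smaller; antipodal vertices have opposite tilts.  Give an edge
    the weight 1 in Z/2 if it is red and its ends have different tilts.  The sum
    of the weights around a resolved square is 0, and around an unresolved square
    it is 1 exactly when the pair of red labels crosses the pair of blue labels
    in the order ([circulationE]).

    For a vertex v, the vertices obtained by flipping the coordinates of v in an
    interval [a, b[ form a triangular grid of squares.  Its boundary consists of
    a path from v to its antipode and of the antipodal image of that path.  The
    weights of an edge and of its antipodal edge add up to the change of tilt
    along the edge, so the boundary sum is the change of tilt from v to its
    antipode, that is 1.  Hence, by Stokes, every triangle contains a square with
    circulation 1 ([exists_circulation]).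

    Now choose the order at random.  Among the three ways to split four labels
    into two pairs exactly one is crossed, so an unresolved square has
    circulation 1 with probability 1/3 ([card_crossed]), and every triangle
    contains at least three unresolved squares.  Summing over the 2 ^ n
    triangles, where a given square occurs at most 4 times ([sum_squares_le]),
    yields at least 3 * 2 ^ n / 4 unresolved squares. *)

(** * Random orders and crossing pairs *)

(** The permutations of T serve as the linear orders on T. *)
Definition below (T : finType) (s : {perm T}) (x y : T) : bool :=
  enum_rank (s x) < enum_rank (s y).

(** For four distinct points, an odd number of the comparisons hold exactly when
    one of y1, y2 lies between x1 and x2 and the other does not. *)
Definition crossed (T : finType) (s : {perm T}) (x1 x2 y1 y2 : T) : bool :=
  below s x1 y1 (+) below s x1 y2 (+) below s x2 y1 (+) below s x2 y2.

Lemma belowC (T : finType) (s : {perm T}) (x y : T) :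
  x != y -> below s y x = ~~ below s x y.
Proof.
move=> xy; rewrite /below -leqNgt ltn_neqAle andb_idl // => _.
by rewrite (inj_eq val_inj) (inj_eq enum_rank_inj) (inj_eq perm_inj) eq_sym.
Qed.

(** Four points on a line can be split into two pairs in three ways, and only the
    splitting into first and third, second and fourth point is crossing. *)
Lemma exactly_one_crossing (a b c d : nat) : uniq [:: a; b; c; d] ->
  let x (k l m o : nat) := (k < m) (+) (k < o) (+) (l < m) (+) (l < o) in
  x a b c d + x a c b d + x a d c b = 1.
Proof.
rewrite /= !inE !negb_or => /and4P[/and3P[ab ac ad] /andP[bc bd] cd _].
lia.
Qed.

(** Two given disjoint pairs cross in one third of the orders: transpositions
    carry the three splittings of the four points to each other, so the three
    are crossed equally often. *)
Lemma card_crossed (T : finType) (x1 x2 y1 y2 : T) :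
    uniq [:: x1; x2; y1; y2] ->
  3 * \sum_(s : {perm T}) crossed s x1 x2 y1 y2 = #|{perm T}|.
Proof.
move=> U; have := U; rewrite /= !inE !negb_or.
move=> /and4P[/and3P[ab ac ad] /andP[bc bd] cd _].
have eq1 : \sum_(s : {perm T}) crossed s x1 y1 x2 y2 =
           \sum_(s : {perm T}) crossed s x1 x2 y1 y2.
  rewrite (reindex_inj (mulgI (tperm x2 y1))) /=; apply: eq_bigr => s _.
  by rewrite /crossed /below !permM tpermL tpermR !tpermD // eq_sym.
have eq2 : \sum_(s : {perm T}) crossed s x1 y2 y1 x2 =
           \sum_(s : {perm T}) crossed s x1 x2 y1 y2.
  rewrite (reindex_inj (mulgI (tperm x2 y2))) /=; apply: eq_bigr => s _.
  by rewrite /crossed /below !permM tpermL tpermR !tpermD // eq_sym.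
rewrite !mulSn mul0n addn0 -{2}eq1 -{2}eq2 addnA -!big_split /=.
rewrite -sum1_card; apply: eq_bigr => s _.
apply: exactly_one_crossing.
have inj : injective (fun x => enum_rank (s x) : nat).
  by move=> x y /val_inj /enum_rank_inj /perm_inj.
by rewrite -(map_inj_uniq inj) in U.
Qed.

(** * Stokes' formula on a triangular grid *)

Lemma addb_telescope (f : nat -> bool) (m : nat) :
  \big[addb/false]_(i < m) (f i (+) f i.+1) = f 0 (+) f m.
Proof.
elim: m => [|m IH]; first by rewrite big_ord0 addbb.
by rewrite big_ord_recr /= IH; case: (f m); case: (f 0); case: (f _).
Qed.

(** The grid points are the (i, j) with i <= j <= m; [h i j] is the edge from
    (i, j) to (i.+1, j) and [g i j] the edge from (i, j) to (i, j.+1).  Inner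
    edges cancel mod 2, and the hypothesis cancels those of the staircase along
    the diagonal, which leaves the two other sides of the triangle. *)
Lemma stokes_triangle (g h : nat -> nat -> bool) (m : nat) :
    (forall i, g i i = h i i.+1) ->
  \big[addb/false]_(j < m) \big[addb/false]_(i < j)
     (h i j (+) g i.+1 j (+) h i j.+1 (+) g i j) =
  \big[addb/false]_(i < m) (g 0 i (+) h i m).
Proof.
move=> gh; rewrite big_split /=.
have column : \big[addb/false]_(j < m) (h j j.+1 (+)
    \big[addb/false]_(i < j) (h i j (+) h i j.+1)) =
  \big[addb/false]_(i < m) h i m.
  elim: m => [|m IH]; first by rewrite !big_ord0.
  rewrite big_ord_recr /= IH addbCA -big_split /= [RHS]big_ord_recr /= addbC.
  by congr (_ (+) _); apply: eq_bigr => i _; rewrite addKb.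
rewrite -column -big_split; apply: eq_bigr => j _ /=.
rewrite -gh addbA -(addb_telescope (g^~ j)) -big_split.
apply: eq_bigr => i _ /=.
by case: (h i j); case: (h _ _); case: (g _ _); case: (g _ _).
Qed.

(** * Colours and components *)

Lemma antipodeK (n : nat) : involutive (@antipode n).
Proof. by move=> v; apply/ffunP => k; rewrite !ffunE negbK. Qed.

Lemma adj_antipode (n : nat) (u v : vertex n) :
  adj (antipode u) (antipode v) = adj u v.
Proof.
rewrite /adj; congr (#|pred_of_set _| == 1); apply/setP => k.
by rewrite !inE !ffunE; case: (u k); case: (v k).
Qed.

Lemma adjC (n : nat) (u v : vertex n) : adj u v = adj v u.
Proof.
rewrite /adj; congr (#|pred_of_set _| == 1); apply/setP => k.
by rewrite !inE eq_sym.
Qed.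

Lemma has_colourC (n : nat) (c : colouring n) (b : bool) :
  symmetric (has_colour c b).
Proof. by move=> u v; apply: eq_existsb => e; rewrite setUC. Qed.

Lemma edge_of_adj (n : nat) (u v : vertex n) :
  adj u v -> [set u; v] \in edges n.
Proof.
move=> uv; rewrite inE; apply/existsP; exists u; apply/existsP; exists v.
by rewrite uv /=.
Qed.

Lemma has_colourN (n : nat) (c : colouring n) (u v : vertex n) :
  adj u v -> has_colour c false u v = ~~ has_colour c true u v.
Proof.
move=> /edge_of_adj uv; pose e0 : edge n := Sub [set u; v] uv.
have E b : has_colour c b u v = (c e0 == b).
  apply/existsP/idP => [[e /andP[/eqP ee ce]] | ce].
    by rewrite (_ : e0 = e) //; apply: val_inj; rewrite ee.
  by exists e0; rewrite eqxx.
by rewrite !E; case: (c e0).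
Qed.

Lemma has_colour_antipode (n : nat) (c : colouring n) (b : bool)
    (u v : vertex n) :
    antipodal c -> has_colour c b u v ->
  has_colour c (~~ b) (antipode u) (antipode v).
Proof.
move=> hc /existsP[e /andP[/eqP ee /eqP ce]].
have im : [set antipode x | x in val e] = [set antipode u; antipode v].
  by rewrite ee imsetU1 imset_set1.
have e'P : [set antipode u; antipode v] \in edges n.
  have := valP e; rewrite inE => /existsP[x /existsP[y /andP[xy /eqP exy]]].
  by rewrite -im exy imsetU1 imset_set1 edge_of_adj // adj_antipode.
pose e' : edge n := Sub [set antipode u; antipode v] e'P.
apply/existsP; exists e'; rewrite /= eqxx /=.
have := hc e e'; rewrite im => /(_ erefl).
by rewrite ce; case: b ce => _; case: (c _).
Qed.

Definition red_comp (n : nat) (c : colouring n) (v : vertex n) : vertex n :=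
  root (has_colour c true) v.

(** The blue components are labelled by red ones: the antipodal map carries the
    blue component of v onto the red component of [antipode v]. *)
Definition blue_comp (n : nat) (c : colouring n) (v : vertex n) : vertex n :=
  red_comp c (antipode v).

Lemma red_compP (n : nat) (c : colouring n) (u v : vertex n) :
  reflect (red_comp c u = red_comp c v) (connect (has_colour c true) u v).
Proof. exact/rootP/sym_connect_sym/has_colourC. Qed.

Lemma blue_compP (n : nat) (c : colouring n) (u v : vertex n) :
    antipodal c ->
  reflect (blue_comp c u = blue_comp c v) (connect (has_colour c false) u v).
Proof.
move=> hc; have H b x y : connect (has_colour c b) x y ->
    connect (has_colour c (~~ b)) (antipode x) (antipode y).
  case/connectP => p; elim: p x => [|z p IH] x /=; first by move=> _ ->.
  case/andP=> xz zp ly; apply: connect_trans (IH z zp ly).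
  exact/connect1/has_colour_antipode.
apply: (iffP idP) => [/H /red_compP // | /red_compP /H].
by rewrite !antipodeK.
Qed.

Lemma mono_joined_comp (n : nat) (c : colouring n) (u v : vertex n) :
    antipodal c ->
  reflect (red_comp c u = red_comp c v \/ blue_comp c u = blue_comp c v)
          (mono_joinedb c u v).
Proof.
move=> hc; apply: (iffP existsP) => [[[] uv] | [uv | uv]].
- by left; apply/red_compP.
- by right; apply/blue_compP.
- by exists true; apply/red_compP.
- by exists false; apply/blue_compP.
Qed.

Lemma adj_comp (n : nat) (c : colouring n) (u v : vertex n) :
    antipodal c -> adj u v ->
  if has_colour c true u v then red_comp c u = red_comp c v
  else blue_comp c u = blue_comp c v.
Proof.
move=> hc uv; have := has_colourN c uv.
case: ifP => [r _ | _ b]; first exact/red_compP/connect1.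
exact/blue_compP/connect1.
Qed.

(** * Circulation around a square *)

Definition tilt (n : nat) (c : colouring n) (s : {perm vertex n})
    (v : vertex n) : bool :=
  below s (red_comp c v) (blue_comp c v).

Lemma tilt_antipode (n : nat) (c : colouring n) (s : {perm vertex n})
    (v : vertex n) :
  red_comp c v != blue_comp c v -> tilt c s (antipode v) = ~~ tilt c s v.
Proof. by move=> v_free; rewrite /tilt /blue_comp antipodeK belowC. Qed.

Definition weight (n : nat) (c : colouring n) (s : {perm vertex n})
    (u v : vertex n) : bool :=
  has_colour c true u v && (tilt c s u (+) tilt c s v).

Lemma weightC (n : nat) (c : colouring n) (s : {perm vertex n})
    (u v : vertex n) :
  weight c s u v = weight c s v u.
Proof. by rewrite /weight has_colourC addbC. Qed.

(** Exactly one of the two edges is red, and the tilt changes along both or along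
    neither. *)
Lemma weight_antipode (n : nat) (c : colouring n) (s : {perm vertex n})
    (u v : vertex n) :
    antipodal c -> (forall x, red_comp c x != blue_comp c x) -> adj u v ->
  weight c s u v (+) weight c s (antipode u) (antipode v) =
  tilt c s u (+) tilt c s v.
Proof.
move=> hc free uv; rewrite /weight !tilt_antipode //.
have -> : has_colour c true (antipode u) (antipode v) = ~~ has_colour c true u v.
  rewrite -has_colourN //; apply/idP/idP => /(has_colour_antipode hc) //.
  by rewrite !antipodeK.
by case: (has_colour _ _ _ _); case: (tilt _ _ _); case: (tilt _ _ _).
Qed.

Definition circulation (n : nat) (c : colouring n) (s : {perm vertex n})
    (u a w b : vertex n) : bool :=
  weight c s u a (+) weight c s a w (+) weight c s w b (+) weight c s b u.

(** For a 4-cycle u a w b, this says that the square is unresolved. *)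
Definition separated (n : nat) (c : colouring n) (u a w b : vertex n) : bool :=
  [&& red_comp c u != red_comp c w, blue_comp c u != blue_comp c w,
      red_comp c a != red_comp c b & blue_comp c a != blue_comp c b].

(** If two consecutive edges have the same colour, then their outer ends share a
    component, so the square is not separated, and a direct check shows that the
    weights cancel.  Otherwise the colours alternate, the two red edges cover the
    four vertices, and the circulation is the sum of the four tilts; these
    compare each of the two red labels with each of the two blue ones. *)
Lemma circulationE (n : nat) (c : colouring n) (s : {perm vertex n})
    (u a w b : vertex n) :
    antipodal c -> adj u a -> adj a w -> adj w b -> adj b u ->
  circulation c s u a w b =
  separated c u a w b &&
    crossed s (red_comp c u) (red_comp c w) (blue_comp c u) (blue_comp c w).
Proof.
move=> hc /(adj_comp hc) ua /(adj_comp hc) aw /(adj_comp hc) wb.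
move=> /(adj_comp hc) bu; move: ua aw wb bu.
rewrite /circulation /separated /weight /tilt /crossed.
move: (red_comp c u) (red_comp c a) (red_comp c w) (red_comp c b).
move: (blue_comp c u) (blue_comp c a) (blue_comp c w) (blue_comp c b).
move=> qu qa qw qb pu pa pw pb.
case: (has_colour c true u a) => E1; case: (has_colour c true a w) => E2;
case: (has_colour c true w b) => E3; case: (has_colour c true b u) => E4;
subst; rewrite ?eqxx ?andbF //=; try (case: eqVneq => [->|_] //=);
try (case: eqVneq => [->|_] //=);
repeat (case: (below _ _ _) => //=).
Qed.

Lemma separated_uniq (n : nat) (c : colouring n) (u a w b : vertex n) :
    antipodal c -> (forall x, red_comp c x != blue_comp c x) ->
    adj u a -> adj a w -> adj w b -> adj b u -> separated c u a w b ->
  uniq [:: red_comp c u; red_comp c w; blue_comp c u; blue_comp c w].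
Proof.
move=> hc free /(adj_comp hc) ua /(adj_comp hc) aw /(adj_comp hc) wb.
move=> /(adj_comp hc) bu; rewrite /separated /= !inE !negb_or.
move: (free u) (free a) (free w) (free b) ua aw wb bu.
move: (red_comp c u) (red_comp c a) (red_comp c w) (red_comp c b).
move: (blue_comp c u) (blue_comp c a) (blue_comp c w) (blue_comp c b).
move=> qu qa qw qb pu pa pw pb fu fa fw fb.
case: (has_colour c true u a) => E1; case: (has_colour c true a w) => E2;
case: (has_colour c true w b) => E3; case: (has_colour c true b u) => E4;
subst; rewrite ?eqxx ?andbF //= => /and4P[-> -> _ _];
by rewrite ?fu ?fa ?fw ?fb.
Qed.

(** * The triangle of squares spanned by a vertex *)

Definition shift (n : nat) (v : vertex n) (a b : nat) : vertex n :=
  [ffun k : 'I_n => v k (+) (a <= k < b)].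

Lemma adj_differ_at (n : nat) (u v : vertex n) (i : 'I_n) :
  (forall k, (u k != v k) = (k == i)) -> adj u v.
Proof.
move=> uv; apply/cards1P; exists i; apply/setP => k; by rewrite !inE uv.
Qed.

Lemma adj_shiftl (n : nat) (v : vertex n) (a b : nat) :
  a < b <= n -> adj (shift v a b) (shift v a.+1 b).
Proof.
case/andP=> ab bn.
apply: (@adj_differ_at _ _ _ (Ordinal (leq_trans ab bn))) => k.
by rewrite !ffunE -val_eqE /=; lia.
Qed.

Lemma adj_shiftr (n : nat) (v : vertex n) (a b : nat) :
  a <= b < n -> adj (shift v a b) (shift v a b.+1).
Proof.
case/andP=> ab bn; apply: (@adj_differ_at _ _ _ (Ordinal bn)) => k.
by rewrite !ffunE -val_eqE /=; lia.
Qed.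

Lemma shift_antipode (n : nat) (v : vertex n) (a : nat) : a <= n ->
  shift v a n = antipode (shift v 0 a).
Proof.
move=> an; apply/ffunP => k; rewrite !ffunE.
by have := ltn_ord k; case: (v k); lia.
Qed.

Lemma shift_id (n : nat) (v : vertex n) (a b : nat) : b <= a -> shift v a b = v.
Proof.
by move=> ab; apply/ffunP => k; rewrite !ffunE; case: (v k); lia.
Qed.

(** The grid points are the vertices [shift v a b].  The whole diagonal collapses
    to v, so that the two edges of the staircase at [shift v i i.+1] coincide.
    The sides a = 0 and b = n are antipodal to each other, so their weights add
    up to the change of tilt from v to its antipode. *)
Lemma exists_circulation (n : nat) (c : colouring n) (s : {perm vertex n})
    (v : vertex n) :
    antipodal c -> (forall x, red_comp c x != blue_comp c x) ->
  exists i : 'I_n, exists2 j : 'I_n, i < j &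
    circulation c s (shift v i j) (shift v i.+1 j)
      (shift v i.+1 j.+1) (shift v i j.+1).
Proof.
move=> hc free; pose g i j := weight c s (shift v i j) (shift v i j.+1).
pose h i j := weight c s (shift v i j) (shift v i.+1 j).
have gh i : g i i = h i i.+1.
  by rewrite /g /h weightC [shift v i i]shift_id // [shift v i.+1 _]shift_id.
have bdry : \big[addb/false]_(i < n) (g 0 i (+) h i n) = true.
  transitivity (\big[addb/false]_(i < n)
      (tilt c s (shift v 0 i) (+) tilt c s (shift v 0 i.+1))).
    apply: eq_bigr => i _; rewrite -weight_antipode //; last first.
      by rewrite adj_shiftr /=.
    by rewrite /g /h !shift_antipode // ltnW.
  rewrite (addb_telescope (fun i => tilt c s (shift v 0 i))).
  have -> : shift v 0 n = antipode v by rewrite shift_antipode // shift_id.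
  by rewrite shift_id // tilt_antipode // addbN addbb.
have := stokes_triangle n gh; rewrite bdry => total.
suff /existsP[i /existsP[j /andP[ij sq]]] :
    [exists i : 'I_n, exists j : 'I_n, (i < j) &&
      circulation c s (shift v i j) (shift v i.+1 j)
        (shift v i.+1 j.+1) (shift v i j.+1)].
  by exists i, j.
apply: contraPT total => /existsPn none.
rewrite big1 // => j _; rewrite big1 // => i _.
have := none (widen_ord (ltnW (ltn_ord j)) i).
rewrite negb_exists => /forallP/(_ j).
rewrite /= ltn_ord /= /circulation => /negbTE <-.
by rewrite /h /g (weightC _ _ (shift v i.+1 j.+1))
  (weightC _ _ (shift v i j.+1) (shift v i j)).
Qed.

Lemma mem_face_shift (n : nat) (v x : vertex n) (i j : 'I_n) : i < j ->
  x \in face (shift v i.+1 j) i j ->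
  x = shift v (i + (x i == v i)) (j + (x j != v j)).
Proof.
move=> ij; rewrite inE => /forallP xP; apply/ffunP => k; rewrite ffunE.
have := xP k; rewrite -!val_eqE /= ffunE.
case: (altP (k =P i)) => [-> _ | ki].
  by case: (x i); case: (v i); case: (x j); case: (v j); lia.
case: (altP (k =P j)) => [-> _ | kj].
  by case: (x i); case: (v i); case: (x j); case: (v j); lia.
move: ki kj; rewrite -!val_eqE /= => ki kj; rewrite ki kj /= => /eqP ->.
by case: (x i == v i); case: (x j != v j); case: (v k); lia.
Qed.

Lemma separated_unresolved (n : nat) (c : colouring n) (v : vertex n)
    (i j : 'I_n) :
    antipodal c -> i < j ->
    separated c (shift v i j) (shift v i.+1 j)
      (shift v i.+1 j.+1) (shift v i j.+1) ->
  face (shift v i.+1 j) i j \in unresolved_squares c.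
Proof.
move=> hc ij sep; rewrite !inE; apply/andP; split.
  apply/existsP; exists (shift v i.+1 j).
  apply/existsP; exists i; apply/existsP; exists j.
  by rewrite eqxx andbT neq_ltn ij.
apply/negP => /existsP[x /existsP[y /andP[/and4P[xF yF xy nadj]]]].
move=> /(mono_joined_comp _ _ hc).
have jn := ltn_ord j.
have A1 : adj (shift v i j) (shift v i.+1 j) by apply: adj_shiftl; lia.
have A2 : adj (shift v i j.+1) (shift v i.+1 j.+1) by apply: adj_shiftl; lia.
have A3 : adj (shift v i j) (shift v i j.+1) by apply: adj_shiftr; lia.
have A4 : adj (shift v i.+1 j) (shift v i.+1 j.+1) by apply: adj_shiftr; lia.
move: sep xy nadj; rewrite (mem_face_shift ij xF) (mem_face_shift ij yF).
case/and4P=> s1 s2 s3 s4.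
(* Among the 16 pairs of corners, only the opposite ones are distinct and
   non-adjacent. *)
case: (x i == v i); case: (x j != v j);
case: (y i == v i); case: (y j != v j);
rewrite ?addn1 ?addn0 ?eqxx // => _; rewrite ?A1 ?A2 ?A3 ?A4 //
  1?adjC ?A1 ?A2 ?A3 ?A4 // => _ [] E;
by move: s1 s2 s3 s4; rewrite E eqxx.
Qed.

(** * Counting squares *)

Lemma face_inj (n : nat) (u u' : vertex n) (i j i' j' : 'I_n) :
    i < j -> i' < j' -> face u i j = face u' i' j' ->
  [/\ i = i', j = j' & forall k, k != i -> k != j -> u k = u' k].
Proof.
move=> ij ij' E.
(* Flipping coordinate k stays in the second face, hence in the first one. *)
have dir k : k \in [:: i'; j'] -> k \in [:: i; j].
  move=> k'; rewrite !inE; apply/negPn/negP; rewrite negb_or => kk.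
  pose y : vertex n := [ffun l => u' l (+) (l == k)].
  have uF : u' \in face u i j.
    by rewrite E inE; apply/forallP => l; apply/implyP.
  have yF : y \in face u i j.
    rewrite E inE; apply/forallP => l; apply/implyP; rewrite ffunE.
    by case: (altP (l =P k)) k' => [->|]; rewrite ?addbF // !inE -negb_or => ->.
  move: uF yF; rewrite !inE => /forallP/(_ k); rewrite kk /= => /eqP uk.
  by move=> /forallP/(_ k); rewrite kk /= ffunE eqxx addbT -uk; case: (u' k).
have [ii jj] : i = i' /\ j = j'.
  have := dir i'; have := dir j'; rewrite !inE !eqxx !orbT -!val_eqE /=.
  move=> /(_ isT) a /(_ isT) b; split; apply: val_inj => /=; lia.
split=> // k ki kj.
have : u \in face u' i' j'.
  by rewrite -E inE; apply/forallP => l; apply/implyP.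
by rewrite inE => /forallP/(_ k); rewrite -ii -jj ki kj => /eqP.
Qed.

(** For fixed directions i < j the base point of the square runs over all vertices
    as v does; the face determines i and j, and then the base point up to its
    values at these two coordinates, whence the factor 4. *)
Lemma sum_squares_le (n : nat) (A : {set {set vertex n}}) :
  \sum_(v : vertex n) \sum_(ij : 'I_n * 'I_n | ij.1 < ij.2)
     (face (shift v ij.1.+1 ij.2) ij.1 ij.2 \in A) <= 4 * #|A|.
Proof.
rewrite exchange_big /=.
under eq_bigr => ij _.
  have shiftK : involutive (fun v : vertex n => shift v ij.1.+1 ij.2).
    by move=> v; apply/ffunP => k; rewrite !ffunE addbK.
  rewrite (reindex_inj (inv_inj shiftK)).
  under eq_bigr => v _ do rewrite shiftK.
  over.
rewrite pair_big /= -big_mkcondr sum1_card.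
pose f (t : 'I_n * 'I_n * vertex n) :=
  (face t.2 t.1.1 t.1.2, (t.2 t.1.1, t.2 t.1.2)).
rewrite -(@card_in_image _ _ f) => [|[[i j] u] [[i' j'] u'] /=]; last first.
  rewrite /in_mem /= => /andP[/andP[ij _] _] /andP[/andP[ij' _] _] [E ui uj].
  have [Ei Ej uu] := face_inj ij ij' E; subst.
  congr (_, _); apply/ffunP => k.
  case: (eqVneq k i') => [->|ki] //; case: (eqVneq k j') => [->|kj] //.
  exact: uu.
rewrite [4 * _](_ : _ = #|setX A [set: bool * bool]|); last first.
  by rewrite cardsX cardsT card_prod card_bool mulnC.
apply/subset_leq_card/subsetP => y /imageP[t /andP[_ tA] ->].
by rewrite !inE tA.
Qed.

Theorem theorem1p4 (n : nat) (hn : 3 <= n) (c : colouring n)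
    (hc : antipodal c)
    (hsq : #|unresolved_squares c| < 3 * 2 ^ (n - 2)) :
  exists v : vertex n, mono_joined c v (antipode v).
Proof.
suff /existsP[v /mono_joinedP vP] : [exists v, mono_joinedb c v (antipode v)].
  by exists v.
apply: contraLR hsq => /existsPn none; rewrite -leqNgt.
have free x : red_comp c x != blue_comp c x.
  by apply: contraNN (none x) => /eqP xx; apply/(mono_joined_comp _ _ hc); left.
pose sq v (ij : 'I_n * 'I_n)
    (F : vertex n -> vertex n -> vertex n -> vertex n -> bool) :=
  F (shift v ij.1 ij.2) (shift v ij.1.+1 ij.2)
    (shift v ij.1.+1 ij.2.+1) (shift v ij.1 ij.2.+1).
pose M := #|{perm vertex n}|.
have M_gt0 : 0 < M by apply/card_gt0P; exists 1%g.
(* An unresolved square has circulation 1 in a third of the orders, a resolved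
   one in none. *)
have upper v (ij : 'I_n * 'I_n) : ij.1 < ij.2 ->
    3 * \sum_s sq v ij (circulation c s) <=
    M * (face (shift v ij.1.+1 ij.2) ij.1 ij.2 \in unresolved_squares c).
  case: ij => i j /= ij; have jn := ltn_ord j.
  have A1 : adj (shift v i j) (shift v i.+1 j) by apply: adj_shiftl; lia.
  have A2 : adj (shift v i.+1 j) (shift v i.+1 j.+1) by apply: adj_shiftr; lia.
  have A3 : adj (shift v i.+1 j.+1) (shift v i j.+1).
    by rewrite adjC; apply: adj_shiftl; lia.
  have A4 : adj (shift v i j.+1) (shift v i j).
    by rewrite adjC; apply: adj_shiftr; lia.
  under eq_bigr => s _ do rewrite /sq /= circulationE //.
  case: (boolP (separated c _ _ _ _)) => [sep | _]; last by rewrite big1.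
  rewrite card_crossed; last exact: separated_uniq sep.
  by rewrite separated_unresolved // muln1.
(* For each of the M orders, every triangle has a square with circulation 1. *)
have lower : 2 ^ n * M <=
    \sum_(v : vertex n) \sum_(ij : 'I_n * 'I_n | ij.1 < ij.2)
      \sum_s sq v ij (circulation c s).
  have -> : 2 ^ n = #|vertex n| by rewrite card_ffun card_bool card_ord.
  rewrite -sum_nat_const leq_sum // => v _.
  rewrite exchange_big /= /M -sum1_card leq_sum // => s _.
  have [i [j ij sqij]] := exists_circulation s v hc free.
  by rewrite (bigD1 (i, j)) //= /sq /= sqij.
suff : 4 * (3 * 2 ^ (n - 2)) * M <= 4 * #|unresolved_squares c| * M.
  by rewrite leq_pmul2r // leq_pmul2l.
have -> : 4 * (3 * 2 ^ (n - 2)) = 3 * 2 ^ n.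
  by rewrite mulnCA (_ : 4 = 2 ^ 2) // -expnD subnKC // ltnW.
rewrite -mulnA (leq_trans (leq_mul (leqnn 3) lower)) // mulnC.
rewrite [leqRHS]mulnC (leq_trans _ (leq_mul (leqnn M) (sum_squares_le _))) //.
rewrite mulnC !big_distrr leq_sum // => v _.
rewrite !big_distrr leq_sum // => ij ij_lt; exact: upper.
Qed.
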